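(* Fix $\sigma_\theta,\sigma_x>0$. For each $N\ge1$, let $X_1,\dots,X_N$ be i.i.d. $\mathcal{N}(\theta^\dagger,\sigma_x^2)$ with $\theta^\dagger=1$, and let $$\mu_p=\frac{\sum_{i=1}^N X_i}{\sigma_x^2/\sigma_\theta^2+N},\qquad \sigma_p^2=\left(\frac{1}{\sigma_\theta^2}+\frac{N}{\sigma_x^2}\right)^{-1}$$ be the posterior mean and variance of $\theta$ under the model $\theta\sim\mathcal{N}(0,\sigma_\theta^2)$, $X_i\mid\theta\stackrel{iid}{\sim}\mathcal{N}(\theta,\sigma_x^2)$. Consider the SGLD recursion with $\theta_0=0$, $$\theta_{k+1}=(1-Ah)\theta_k+B_kh+\sqrt h\,\xi_k,\qquad A=\tfrac12\left(\tfrac{1}{\sigma_\theta^2}+\tfrac{N}{\sigma_x^2}\right),\quad B_k=\frac{N}{n}\frac{\sum_{i=1}^n X_{\tau_{ki}}}{2\sigma_x^2},$$ where $\xi_k$ are i.i.d. $\mathcal{N}(0,1)$ and, independently for each $k$, $(\tau_{k1},\dots,\tau_{kn})$ is a random subset of $\{1,\dots,N\}$ of size $n$. Let $\epsilon>0$ and choose $h=N^{-1-\epsilon}$, $M=N^{1+2\epsilon}$ and $n=1$. Then $$\lim_{N\to\infty}\mathbb{E}\left(\frac1M\sum_{j=0}^{M-1}\theta_j^2-(\mu_p^2+\sigma_p^2)\right)^2=0,$$ where the expectation is taken jointly over the data $X_1,\dots,X_N$, the subsampling indices and the Gaussian noise $\xi_k$. *)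

(* Defs.v *)
From HB Require Import structures.
From mathcomp Require Import all_boot all_order all_algebra.
From mathcomp Require Import all_classical all_reals all_analysis.
Set Implicit Arguments. Unset Strict Implicit. Unset Printing Implicit Defensive.
Import Order.TTheory GRing.Theory Num.Theory.
Local Open Scope classical_set_scope.
Local Open Scope ring_scope.

Definition mutually_independent {d} {T : measurableType d} {R : realType}
  (P : probability T R) (I : eqType) (S : pred I) (F : I -> set (set T)) :=
  forall (J : seq I) (A : I -> set T), uniq J ->
    (forall j, j \in J -> S j) ->
    (forall j, j \in J -> F j (A j)) ->
    P [set w | forall j, j \in J -> A j w] = (\prod_(j <- J) P (A j))%E.

Definition preimages_R {d} {T : measurableType d} {R : realType}
  (f : T -> R) : set (set T) :=
  [set A | exists2 B : set R, measurable B & A = f @^-1` B].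

Definition preimages_nat {T : Type} (f : T -> nat) : set (set T) :=
  [set A | exists B : set nat, A = f @^-1` B].

(* Index type for the random inputs of the SGLD experiment with data size N:
   inl (inl i) : data X_i (1 <= i <= N);
   inl (inr k) : subsampling index tau_k (n = 1), k >= 0;
   inr k       : Gaussian noise xi_k, k >= 0. *)
Definition sgld_index := ((nat + nat) + nat)%type.

Definition sgld_valid (N : nat) : pred sgld_index :=
  fun j => match j with
           | inl (inl i) => (1 <= i <= N)%N
           | _ => true
           end.

Definition sgld_sigma {d} {T : measurableType d} {R : realType}
  (X : nat -> T -> R) (tau : nat -> T -> nat) (xi : nat -> T -> R)
  (j : sgld_index) : set (set T) :=
  match j with
  | inl (inl i) => preimages_R (X i)
  | inl (inr k) => preimages_nat (tau k)
  | inr k => preimages_R (xi k)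
  end.

Definition sgld_A {R : realType} (st sx : R) (N : nat) : R :=
  ((st ^+ 2)^-1 + N%:R / sx ^+ 2) / 2.

Fixpoint sgld_theta {T : Type} {R : realType} (st sx : R) (N : nat) (h : R)
  (X : nat -> T -> R) (tau : nat -> T -> nat) (xi : nat -> T -> R)
  (k : nat) (w : T) : R :=
  match k with
  | 0 => 0
  | k'.+1 =>
      (1 - sgld_A st sx N * h) * sgld_theta st sx N h X tau xi k' w
      + (N%:R / 1%:R) * X (tau k' w) w / (2 * sx ^+ 2) * h
      + Num.sqrt h * xi k' w
  end.

Definition post_mean {T : Type} {R : realType} (st sx : R) (N : nat)
  (X : nat -> T -> R) (w : T) : R :=
  (\sum_(1 <= i < N.+1) X i w) / (sx ^+ 2 / st ^+ 2 + N%:R).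

Definition post_var {R : realType} (st sx : R) (N : nat) : R :=
  ((st ^+ 2)^-1 + N%:R / sx ^+ 2)^-1.

(* Main.v *)
(** The error [e_k = theta_k - mu_p] satisfies [e_(k+1) = (1 - u) e_k + Z_k] with
    [u = A h], where [Z_k] gathers the subsampling fluctuation and the Gaussian
    noise. Both are centered and independent of the data and of the past, up to a
    factor [X_i] that can be moved to the past side, so [E (e_k^3 Z_k) = 0].
    Expanding [e_(k+1)^4] and absorbing the other cross terms by AM-GM gives
      [E e_(k+1)^4 <= (1 - u / 2) E e_k^4 + (38 / u) E Z_k^4],
    hence a bound [2 E mu_p^4 / (u M) + 76 sup_k E Z_k^4 / u^2] on the average of
    [E e_j^4] over [j < M]. As [u] is of order [N^-eps], [E Z_k^4] of order
    [N^(-4 eps) + N^(-2 - 2 eps)] and [u M] of order [N^(1 + eps)], it tends to [0].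
    The theorem follows since [theta^2 - mu_p^2 = e^2 + 2 e mu_p] and [mu_p] is
    bounded in [L^4]. *)
Require Import Defs.
From HB Require Import structures.
From mathcomp Require Import all_boot all_order all_algebra.
From mathcomp Require Import all_classical all_reals all_analysis.
From mathcomp Require Import measurable_realfun ring lra.
Set Implicit Arguments. Unset Strict Implicit. Unset Printing Implicit Defensive.
Import Order.TTheory GRing.Theory Num.Theory.
Import numFieldNormedType.Exports.
Local Open Scope classical_set_scope.
Local Open Scope ring_scope.

(** * Elementary inequalities *)

Section real_inequalities.
Context {R : realType}.
Implicit Types (F : nat -> R) (x y a d e m v s : R).

Lemma pow4_ge0 x : 0 <= x ^+ 4.
Proof. by rewrite (exprM _ 2 2) sqr_ge0. Qed.

(** Equivalent to nonnegativity of the sum of the squares [(F i - x) ^+ 2]. With [x = F n] it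
    supplies the cross term in the induction for Cauchy-Schwarz below. *)
Lemma double_mul_sum_le F n x :
  2 * (\sum_(0 <= i < n) F i) * x <= \sum_(0 <= i < n) F i ^+ 2 + n%:R * x ^+ 2.
Proof.
elim: n => [|n IH]; first by rewrite !big_nil; lra.
rewrite !big_nat_recr//= -natr1.
have := sqr_ge0 (F n - x); nra.
Qed.

Lemma sqr_sum_le F n :
  (\sum_(0 <= i < n) F i) ^+ 2 <= n%:R * \sum_(0 <= i < n) F i ^+ 2.
Proof.
elim: n => [|n IH]; first by rewrite !big_nil; lra.
have := double_mul_sum_le F n (F n).
rewrite !big_nat_recr//= -natr1; nra.
Qed.

Lemma sqr_mean_le F n : (0 < n)%N ->
  ((\sum_(0 <= i < n) F i) / n%:R) ^+ 2 <= (\sum_(0 <= i < n) F i ^+ 2) / n%:R.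
Proof.
move=> n0; have n0' : 0 < n%:R :> R by rewrite ltr0n.
rewrite expr_div_n ler_pdivrMr ?exprn_gt0//.
have -> : (\sum_(0 <= i < n) F i ^+ 2) / n%:R * n%:R ^+ 2 =
  n%:R * \sum_(0 <= i < n) F i ^+ 2 by field; rewrite gt_eqF.
exact: sqr_sum_le.
Qed.

(** Jensen's inequality for the square, used twice. *)
Lemma pow4_mean_le F n : (0 < n)%N ->
  ((\sum_(0 <= i < n) F i) / n%:R) ^+ 4 <= (\sum_(0 <= i < n) F i ^+ 4) / n%:R.
Proof.
move=> n0; rewrite (exprM _ 2 2).
apply: (@le_trans _ _ (((\sum_(0 <= i < n) F i ^+ 2) / n%:R) ^+ 2)).
  by rewrite ler_sqr ?nnegrE ?sqr_ge0 ?sqr_mean_le//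
    divr_ge0// sumr_ge0// => i _; exact: sqr_ge0.
apply: le_trans (sqr_mean_le _ n0) _.
by under eq_bigr do rewrite -exprM.
Qed.

Lemma pow4D_le x y : (x + y) ^+ 4 <= 8 * (x ^+ 4 + y ^+ 4).
Proof.
have h2 (p q : R) : (p + q) ^+ 2 <= 2 * (p ^+ 2 + q ^+ 2).
  by have := sqr_ge0 (p - q); lra.
have -> : (x + y) ^+ 4 = ((x + y) ^+ 2) ^+ 2 by rewrite -exprM.
apply: (@le_trans _ _ ((2 * (x ^+ 2 + y ^+ 2)) ^+ 2)).
  by rewrite ler_sqr ?nnegrE ?sqr_ge0// mulr_ge0// addr_ge0// sqr_ge0.
by have := h2 (x ^+ 2) (y ^+ 2); rewrite -!exprM exprMn; lra.
Qed.

(* The quartic expansion, with the quadratic and cubic cross terms absorbed by AM-GM. *)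
Lemma pow4_contraction_le a d x y : 0 <= a <= 1 -> 0 < d <= 1 ->
  (a * x + y) ^+ 4 <=
  (a ^+ 4 + d) * x ^+ 4 + 4 * a ^+ 3 * (x ^+ 3 * y) + 19 / d * y ^+ 4.
Proof.
move=> /andP[a0 a1] /andP[d0 d1].
have x4 : 0 <= x ^+ 2 * y ^+ 2 by rewrite mulr_ge0 ?sqr_ge0.
have y4 : 0 <= y ^+ 4 := pow4_ge0 y.
have a2 : a ^+ 2 <= 1 by rewrite exprn_ile1.
(* This bound raises the coefficient of the quadratic cross term from 6 to 8 and that of [y ^+ 4]
   from 1 to 3. Trading the former for [d * x ^+ 4] costs [16 / d], and [16 / d + 3 / d] is the
   final [19 / d]. *)
have amgm : 4 * a * (x * y ^+ 3) <= 2 * (a ^+ 2 * (x ^+ 2 * y ^+ 2) + y ^+ 4).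
  have -> : 2 * (a ^+ 2 * (x ^+ 2 * y ^+ 2) + y ^+ 4) =
     4 * a * (x * y ^+ 3) + 2 * (y * (a * x - y)) ^+ 2 by ring.
  by rewrite lerDl mulr_ge0// sqr_ge0.
have amgm2 : 8 * (x ^+ 2 * y ^+ 2) <= d * x ^+ 4 + 16 / d * y ^+ 4.
  have -> : d * x ^+ 4 + 16 / d * y ^+ 4 =
     8 * (x ^+ 2 * y ^+ 2) + d * (x ^+ 2 - 4 / d * y ^+ 2) ^+ 2.
    by field; rewrite gt_eqF.
  by rewrite lerDl; apply: mulr_ge0; [exact: ltW|exact: sqr_ge0].
have a2x : a ^+ 2 * (x ^+ 2 * y ^+ 2) <= x ^+ 2 * y ^+ 2 by rewrite ler_piMl.
have y3 : 3 * y ^+ 4 <= 3 / d * y ^+ 4.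
  by rewrite ler_wpM2r// ler_pdivlMr// ler_piMr.
have -> : 19 / d * y ^+ 4 = 16 / d * y ^+ 4 + 3 / d * y ^+ 4 by field; rewrite gt_eqF.
have -> : (a * x + y) ^+ 4 = a ^+ 4 * x ^+ 4 + 4 * a ^+ 3 * (x ^+ 3 * y) +
   6 * (a ^+ 2 * (x ^+ 2 * y ^+ 2)) + 4 * a * (x * y ^+ 3) + y ^+ 4 by ring.
lra.
Qed.

(** Young's inequality with a crude constant. It serves as a dominating function when mixed products
    of fourth-power integrable functions are integrated. *)
Lemma young3_le x y : `|x ^+ 3 * y| <= x ^+ 4 + y ^+ 4.
Proof.
have h (p q : R) : p ^+ 3 * q <= p ^+ 4 + q ^+ 4.
  have e1 : p ^+ 3 * q <= (p ^+ 4 + p ^+ 2 * q ^+ 2) / 2.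
    by have := sqr_ge0 (p ^+ 2 - p * q); lra.
  have e2 : p ^+ 2 * q ^+ 2 <= (p ^+ 4 + q ^+ 4) / 2.
    by have := sqr_ge0 (p ^+ 2 - q ^+ 2); lra.
  have p4 : 0 <= p ^+ 4 := pow4_ge0 p.
  have q4 : 0 <= q ^+ 4 := pow4_ge0 q.
  lra.
rewrite ler_norml h andbT lerNl -mulrN.
by rewrite -[y ^+ 4](_ : (- y) ^+ 4 = _) ?h//; ring.
Qed.

(* The cross term [4 e^2 m^2] is split by AM-GM with weight [s]. *)
Lemma sqr_dev_le e m v s : 0 < s ->
  ((e + m) ^+ 2 - (m ^+ 2 + v)) ^+ 2 <=
  3 * ((1 + s^-1) * e ^+ 4 + 4 * s * m ^+ 4 + v ^+ 2).
Proof.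
move=> s0.
have -> : (e + m) ^+ 2 - (m ^+ 2 + v) = e ^+ 2 + 2 * (e * m) - v by ring.
have h3 (p q r : R) : (p + q - r) ^+ 2 <= 3 * (p ^+ 2 + q ^+ 2 + r ^+ 2).
  by have := sqr_ge0 (p - q); have := sqr_ge0 (p + r); have := sqr_ge0 (q + r); lra.
apply: le_trans (h3 _ _ _) _; rewrite ler_pM2l// lerD2r.
have h : 4 * (e ^+ 2 * m ^+ 2) <= s^-1 * e ^+ 4 + 4 * s * m ^+ 4.
  have -> : s^-1 * e ^+ 4 + 4 * s * m ^+ 4 =
     4 * (e ^+ 2 * m ^+ 2) + s^-1 * (e ^+ 2 - 2 * s * m ^+ 2) ^+ 2.
    by field; rewrite gt_eqF.
  by rewrite lerDl; apply: mulr_ge0; [rewrite invr_ge0 ltW|exact: sqr_ge0].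
have -> : (e ^+ 2) ^+ 2 = e ^+ 4 by rewrite -exprM.
have -> : (2 * (e * m)) ^+ 2 = 4 * (e ^+ 2 * m ^+ 2) by ring.
lra.
Qed.

End real_inequalities.

(** * Independence of a variable from a generated past *)

Section independence.
Context d (T : measurableType d) (R : realType) (P : probability T R).

(** When each [F i] contains [setT] and is stable under intersection, this is a pi-system generating
    the join of the families [F j] for [j] in [J], that is, the past described by [J]. *)
Definition cylinders (I : eqType) (F : I -> set (set T)) (J : seq I) :
    set (set T) :=
  [set C | exists2 A : I -> set T, (forall j, j \in J -> F j (A j)) &
           C = [set w | forall j, j \in J -> A j w]].

Section cylinders.
Context (I : eqType) (S : pred I) (F : I -> set (set T)).
Hypothesis FT : forall i, F i setT.
Hypothesis FI : forall i, setI_closed (F i).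
Hypothesis Fm : forall i, S i -> F i `<=` measurable.

Lemma sub_cylinders J i : i \in J -> F i `<=` cylinders F J.
Proof.
move=> iJ A FA; exists (fun j => if j == i then A else setT).
  by move=> j _; case: eqP => [->|].
apply/seteqP; split => [w Aw j _|w /(_ i iJ)]; last by rewrite eqxx.
by case: eqP.
Qed.

Lemma cylindersT J : cylinders F J setT.
Proof. by exists (fun=> setT) => //; apply/seteqP; split. Qed.

Lemma cylinders_setI J : setI_closed (cylinders F J).
Proof.
move=> _ _ [A FA ->] [B FB ->]; exists (fun i => A i `&` B i).
  by move=> j jJ; apply: FI; [exact: FA|exact: FB].
apply/seteqP; split => [w [Aw Bw] j jJ|w ABw]; first by split; [exact: Aw|exact: Bw].
by split => j /ABw[].
Qed.

Lemma cylinders_measurable J : {subset J <= S} -> cylinders F J `<=` measurable.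
Proof.
move=> + _ [A + ->]; elim: J => [|i J IH] JS FA.
  by rewrite [X in measurable X](_ : _ = setT)//; apply/seteqP; split.
rewrite [X in measurable X](_ : _ = A i `&` [set w | forall j, j \in J -> A j w]).
  apply: measurableI; first by apply: (Fm (JS i (mem_head _ _))); exact/FA/mem_head.
  by apply: IH => j jJ; [apply: JS|apply: FA]; rewrite in_cons jJ orbT.
apply/seteqP; split => [w Aw|w [Aw AJ] j].
  by split=> [|j jJ]; apply: Aw; rewrite in_cons ?eqxx// jJ orbT.
by rewrite in_cons => /orP[/eqP ->|/AJ].
Qed.

(** Uniqueness of measures: both sides are finite measures in [E], and they agree on the pi-system
    of cylinders by mutual independence along [t :: J]. Hence they agree on the generated
    sigma-algebra. *)
Lemma mutually_independent_generated J t B E :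
  mutually_independent P S F -> uniq J -> {subset J <= S} ->
  t \notin J -> S t -> F t B -> <<s cylinders F J >> E ->
  P (E `&` B) = (P E * P B)%E.
Proof.
move=> indep uJ JS tJ St FB.
have mB : measurable B := Fm St FB.
have PBE : (fine (P B))%:E = P B by rewrite fineK// fin_num_measure.
have PB0 : 0 <= fine (P B) by rewrite fine_ge0.
pose m2 : {measure set T -> \bar R} := mscale (NngNum PB0) P.
move=> GE; have -> : P (E `&` B) = mrestr P mB E by [].
have -> : (P E * P B)%E = m2 E by rewrite /m2 /= /mscale /= PBE muleC.
apply: (g_sigma_algebra_measure_unique (cylinders F J) _ (fun=> setT)) GE => //=.
- exact: cylinders_measurable.
- by move=> _; exact: cylindersT.
- by rewrite bigcup_const//; exists 0%N.
- exact: cylinders_setI.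
- move=> _ [A FA ->]; rewrite /mrestr /mscale /= PBE.
  have PA := indep J A uJ JS FA.
  (* The event at [t] is replaced by [B]; since [t] is not in [J], the events of the cylinder are
     unchanged. *)
  have := indep (t :: J) (fun j => if j == t then B else A j).
  have AE j : j \in J -> (if j == t then B else A j) = A j.
    by case: eqP => // -> tJ'; rewrite tJ' in tJ.
  rewrite /= tJ uJ big_cons eqxx PA => /(_ isT) indep'.
  rewrite [X in P X](_ : _ = [set w | forall j, j \in t :: J ->
     (if j == t then B else A j) w]); last first.
    apply/seteqP; split => [w [Aw Bw] j|w Aw].
      by rewrite in_cons; case: eqP => //= _; exact: Aw.
    split=> [j jJ|]; last by have := Aw t; rewrite mem_head eqxx; exact.
    by have := Aw j; rewrite in_cons jJ orbT AE//; exact.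
  rewrite indep'.
  + by congr (_ * _)%E; apply: eq_big_seq => j /AE ->.
  + by move=> j; rewrite in_cons => /orP[/eqP ->|/JS].
  + by move=> j; rewrite in_cons; case: eqP => [->//|_ /FA].
- by move=> _; rewrite /mrestr setTI (le_lt_trans (probability_le1 _ _))// ltry.
Qed.

End cylinders.

(** * Transport of integrals along a known law *)

Section law.
Context d' (T' : measurableType d') (V : T -> T').
Variable nu : {measure set T' -> \bar R}.
Hypothesis mV : measurable_fun setT V.
Hypothesis lawV : forall A, measurable A -> P (V @^-1` A) = nu A.
Local Open Scope ereal_scope.

Let lawE (f : T' -> \bar R) : \int[nu]_y f y = \int[pushforward P V]_y f y.
Proof. by apply: eq_measure_integral => A mA _; rewrite -lawV. Qed.

Lemma ge0_integral_law (f : T' -> \bar R) : measurable_fun setT f ->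
  (forall y, 0 <= f y) -> \int[P]_w f (V w) = \int[nu]_y f y.
Proof. by move=> mf f0; rewrite lawE ge0_integral_pushforward. Qed.

Lemma integrable_lawP (f : T' -> \bar R) : measurable_fun setT f ->
  P.-integrable setT (f \o V) <-> nu.-integrable setT f.
Proof.
move=> mf; have mfV : measurable_fun setT (f \o V) by exact: measurableT_comp.
have E : \int[P]_w `|f (V w)| = \int[nu]_y `|f y|.
  apply: (ge0_integral_law (f := abse \o f)); first exact: measurableT_comp.
  by move=> y; exact: abse_ge0.
by split=> /integrableP[_ fi]; apply/integrableP; split => //;
  [rewrite -E|rewrite /= E].
Qed.

Lemma integral_law (f : T' -> \bar R) : measurable_fun setT f ->
  P.-integrable setT (f \o V) -> \int[P]_w f (V w) = \int[nu]_y f y.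
Proof. by move=> mf fi; rewrite lawE integral_pushforward. Qed.

End law.

(** The joint law of [(Y, W)] agrees with the product of the marginals on rectangles, hence
    everywhere; Fubini then factors the integral of the product of coordinates. *)
Lemma independent_expectationM (Y W : T -> R) :
  measurable_fun setT Y -> measurable_fun setT W ->
  (forall A B, measurable A -> measurable B ->
    P (Y @^-1` A `&` W @^-1` B) = (P (Y @^-1` A) * P (W @^-1` B))%E) ->
  P.-integrable setT (EFin \o Y) -> P.-integrable setT (EFin \o W) ->
  P.-integrable setT (EFin \o (fun w => Y w * W w)) ->
  \int[P]_w (Y w * W w) = (\int[P]_w Y w) * (\int[P]_w W w).
Proof.
move=> mY mW indep iY iW iYW.
pose Y' : {mfun T >-> R} := HB.pack Y (isMeasurableFun.Build _ _ _ _ _ mY).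
pose W' : {mfun T >-> R} := HB.pack W (isMeasurableFun.Build _ _ _ _ _ mW).
pose PY : probability _ R := distribution P Y'.
pose PW : probability _ R := distribution P W'.
pose Z w := (Y w, W w).
have mZ : measurable_fun setT Z by exact: measurable_fun_pair.
pose Z' : {mfun T >-> _} := HB.pack Z (isMeasurableFun.Build _ _ _ _ _ mZ).
have lawZ A : measurable A -> P (Z @^-1` A) = (PY \x PW)%E A.
  move=> mA; rewrite (@product_measure_unique _ _ _ _ _ PY PW (distribution P Z'))//.
pose f (z : R * R) : \bar R := (z.1 * z.2)%:E.
have mf : measurable_fun setT f.
  by apply/measurable_EFinP; apply: measurable_funM.
have iE (V : T -> R) (iV : P.-integrable setT (EFin \o V)) :
  (\int[P]_w (V w)%:E)%E = (\int[P]_w V w)%:E.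
  by rewrite /Rintegral fineK//; exact: integrable_fin_num.
apply: (@EFin_inj R); rewrite EFinM -!iE//.
have -> : (\int[P]_w (Y w * W w)%:E)%E = (\int[(PY \x PW)%E]_z f z)%E.
  exact: (integral_law mZ lawZ mf).
rewrite -integral12_prod_meas1; last exact/(integrable_lawP mZ lawZ mf).
have lawY A : measurable A -> P (Y @^-1` A) = PY A by [].
have lawW A : measurable A -> P (W @^-1` A) = PW A by [].
have mE : measurable_fun [set: R] (@EFin R) by exact/measurable_EFinP.
have iPW : PW.-integrable setT (@EFin R) by exact/(integrable_lawP mW lawW mE).
have iPY : PY.-integrable setT (@EFin R) by exact/(integrable_lawP mY lawY mE).
rewrite (integral_law mY lawY mE)// (integral_law mW lawW mE)//.
have fPW : (\int[PW]_y y%:E)%E \is a fin_num by exact: integrable_fin_num.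
transitivity (\int[PY]_x (x%:E * \int[PW]_y y%:E))%E.
  by apply: eq_integral => x _; rewrite /fubini_F /f -integralZl.
by rewrite -(fineK fPW) integralZr.
Qed.

(** * Centred factors independent of the past *)

Section independent_of_past.
Context (I : eqType) (S : pred I) (F : I -> set (set T)).
Hypothesis FT : forall i, F i setT.
Hypothesis FI : forall i, setI_closed (F i).
Hypothesis Fm : forall i, S i -> F i `<=` measurable.
Hypothesis indep : mutually_independent P S F.
Variables (J : seq I) (t : I).
Hypotheses (uJ : uniq J) (JS : {subset J <= S}) (tJ : t \notin J) (St : S t).

Lemma generated_measurable_fun (Y : g_sigma_algebraType (cylinders F J) -> R) :
  measurable_fun setT Y -> measurable_fun setT (Y : T -> R).
Proof.
move=> mY _ A mA; have := mY measurableT A mA.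
exact: (smallest_sub (@sigma_algebra_measurable _ T) (cylinders_measurable Fm JS)).
Qed.

(** The form in which independence is used: a fresh centred factor kills any factor known from the
    past. Being known from the past is encoded in the type of [Y], which keeps the points of [T] but
    carries the generated sigma-algebra. *)
Lemma independent_past_mul0 (Y : g_sigma_algebraType (cylinders F J) -> R)
    (W : T -> R) :
  measurable_fun setT Y -> measurable_fun setT W ->
  (forall B, measurable B -> F t (W @^-1` B)) ->
  P.-integrable setT (EFin \o (Y : T -> R)) -> P.-integrable setT (EFin \o W) ->
  P.-integrable setT (EFin \o (fun w => (Y : T -> R) w * W w)) ->
  \int[P]_w W w = 0 ->
  \int[P]_w ((Y : T -> R) w * W w) = 0.
Proof.
move=> mY mW FW iY iW iYW W0.
rewrite independent_expectationM ?W0 ?mulr0//.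
  exact: generated_measurable_fun.
move=> A B mA mB.
apply: (mutually_independent_generated FT FI Fm indep uJ JS tJ St (FW _ mB)).
by have := mY measurableT A mA; rewrite setTI.
Qed.

End independent_of_past.
End independence.

(** * Moments of the normal distribution *)

Section normal_moments.
Context {R : realType}.
Local Notation mu := (@lebesgue_measure R).
Implicit Types m s x : R.

(** The Radon-Nikodym derivative of [normal_prob m s] has the same integral as the explicit density
    on every measurable set, so the two are equal almost everywhere. *)
Lemma ge0_integral_normal_prob m s (f : R -> \bar R) :
  measurable_fun setT f -> (forall x, 0 <= f x)%E ->
  (\int[normal_prob m s]_x f x = \int[mu]_x (f x * (normal_pdf m s x)%:E))%E.
Proof.
move=> mf f0.
have dom := normal_prob_dominates m s.
rewrite -(Radon_Nikodym_SigmaFinite.change_of_variables dom)//.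
have iRN := Radon_Nikodym_SigmaFinite.f_integrable dom.
have mpdf := measurable_normal_pdf m s.
apply: ae_eq_integral => //.
- by apply: emeasurable_funM => //; exact: measurable_int iRN.
- by apply: emeasurable_funM => //; exact/measurable_EFinP.
apply: ae_eqe_mul2l; apply: integral_ae_eq => //; first exact/measurable_EFinP.
by move=> A _ mA; rewrite -Radon_Nikodym_SigmaFinite.f_integral.
Qed.

(** Half of the Gaussian exponent absorbs the polynomial factor. The other half is the exponent of
    the density with doubled variance, hence the deviation [Num.sqrt 2 * s]. *)
Lemma pow4_mul_normal_pdf_le m s x : 0 < s ->
  x ^+ 4 * normal_pdf m s x <=
  (8 * (64 * s ^+ 4 + m ^+ 4) * normal_peak s / normal_peak (Num.sqrt 2 * s)) *
  normal_pdf m (Num.sqrt 2 * s) x.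
Proof.
move=> s0; have s'0 : 0 < Num.sqrt 2 * s by rewrite mulr_gt0.
rewrite !normal_pdfE ?gt_eqF// /normal_fun exprMn sqr_sqrtr//.
set p := normal_peak s; set p' := normal_peak _.
have p'0 : 0 < p' by apply: normal_peak_gt0; rewrite gt_eqF.
have p0 : 0 < p by apply: normal_peak_gt0; rewrite gt_eqF.
pose y := (x - m) ^+ 2 / (4 * s ^+ 2).
have y0 : 0 <= y by rewrite divr_ge0 ?sqr_ge0// mulr_ge0 ?sqr_ge0.
have -> : - (x - m) ^+ 2 / (s ^+ 2 *+ 2) = - y - y.
  by rewrite /y; field; rewrite gt_eqF.
have -> : - (x - m) ^+ 2 / ((2 * s ^+ 2) *+ 2) = - y.
  by rewrite /y; field; rewrite gt_eqF.
(* Squaring [1 + y / 2 <= expR (y / 2)]. As [(x - m) ^+ 4] is [16 * s ^+ 4 * y ^+ 2], the factor 4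
   produces the constant 64. *)
have ey : y ^+ 2 <= 4 * expR y.
  have h := expR_ge1Dx (y / 2).
  have -> : expR y = expR (y / 2) ^+ 2 by rewrite expr2 -expRD; congr expR; field.
  have : (1 + y / 2) ^+ 2 <= expR (y / 2) ^+ 2 by rewrite ler_sqr// nnegrE; lra.
  by nra.
have ey1 : 1 <= expR y by rewrite (le_trans _ (expR_ge1Dx _))// lerDl.
have xE : x ^+ 4 <= 8 * (64 * s ^+ 4 + m ^+ 4) * expR y.
  have -> : x = (x - m) + m by ring.
  apply: le_trans (pow4D_le _ _) _; rewrite -mulrA ler_pM2l// mulrDl.
  rewrite lerD//; last by rewrite ler_peMr// pow4_ge0.
  have -> : (x - m) ^+ 4 = 16 * s ^+ 4 * y ^+ 2.
    by rewrite /y; field; rewrite gt_eqF.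
  have s4 : 0 < s ^+ 4 by rewrite exprn_gt0.
  nra.
have -> : 8 * (64 * s ^+ 4 + m ^+ 4) * p / p' * (p' * expR (- y)) =
  (8 * (64 * s ^+ 4 + m ^+ 4) * expR y) * (p * expR (- y - y)).
  rewrite expRD expRN; field; by rewrite !gt_eqF// expR_gt0.
by rewrite ler_pM2r// mulr_gt0// expR_gt0.
Qed.

Lemma normal_prob_integrable_pow4 m s : 0 < s ->
  (normal_prob m s).-integrable setT (fun x => (x ^+ 4)%:E).
Proof.
move=> s0.
have x4 := @pow4_ge0 R.
have mx4 : measurable_fun [set: R] (fun x => (x ^+ 4)%:E).
  by apply/measurable_EFinP; exact: measurable_funX.
apply/integrableP; split => //.
under eq_integral do rewrite gee0_abs ?lee_fin//.
rewrite ge0_integral_normal_prob//.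
set K := (8 * (64 * s ^+ 4 + m ^+ 4) * normal_peak s / normal_peak (Num.sqrt 2 * s)).
have K0 : 0 <= K.
  by rewrite divr_ge0 ?normal_peak_ge0// mulr_ge0 ?normal_peak_ge0// mulr_ge0//
    addr_ge0// mulr_ge0.
apply: (@le_lt_trans _ _ (\int[mu]_x (K%:E * (normal_pdf m (Num.sqrt 2 * s) x)%:E))%E).
  apply: ge0_le_integral => //.
  - by move=> x _; rewrite -EFinM lee_fin mulr_ge0// normal_pdf_ge0.
  - apply: emeasurable_funM => //; apply/measurable_EFinP.
    exact: measurable_normal_pdf.
  - apply: emeasurable_funM => //; apply/measurable_EFinP.
    exact: measurable_normal_pdf.
  - by move=> x _; rewrite -!EFinM lee_fin pow4_mul_normal_pdf_le.
by rewrite integralZl// ?integral_normal_pdf ?mule1 ?ltry//; exact: integrable_normal_pdf.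
Qed.

(** The centred density is even and Lebesgue measure is invariant under reflection. *)
Lemma normal_prob0N s (A : set R) : s != 0 -> measurable A ->
  normal_prob 0 s (-%R @^-1` A) = normal_prob 0 s A.
Proof.
move=> s0 mA; rewrite /normal_prob.
have mN : measurable_fun setT (-%R : measurableTypeR R -> measurableTypeR R).
  exact: oppr_measurable.
transitivity (\int[mu]_(x in -%R @^-1` A)
    (((fun x => (normal_pdf 0 s x)%:E) \o
      (-%R : measurableTypeR R -> measurableTypeR R)) x))%E.
  apply: eq_integral => x _; congr (_%:E).
  by rewrite !normal_pdfE// /normal_fun !subr0 sqrrN.
have mf : measurable_fun A (fun x : measurableTypeR R => (normal_pdf 0 s x)%:E).
  by apply: measurable_funTS; apply/measurable_EFinP; exact: measurable_normal_pdf.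
have f0 : {in A, forall x : measurableTypeR R, 0 <= (normal_pdf 0 s x)%:E}%E.
  by move=> x _; rewrite lee_fin normal_pdf_ge0.
have E := @ge0_integral_pushforward _ _ _ _ R _ mN mu A _ mA mf f0.
rewrite -E.
by apply: eq_measure_integral => //= B mB _; exact: lebesgue_measureN.
Qed.

Lemma normal_prob_integrable m s : 0 < s ->
  (normal_prob m s).-integrable setT (@EFin R).
Proof.
move=> s0.
have i4 := normal_prob_integrable_pow4 m s0.
have i1 : (normal_prob m s).-integrable setT (fun=> 1%:E).
  exact: finite_measure_integrable_cst.
apply: (le_integrable measurableT _ _ (integrableD measurableT i1 i4)).
  exact/measurable_EFinP.
move=> x _ /=; rewrite lee_fin.
have x4 : 0 <= x ^+ 4 := pow4_ge0 x.
rewrite [leRHS]ger0_norm; last by rewrite addr_ge0.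
by have := young3_le 1 x; rewrite !expr1n mul1r.
Qed.

Lemma normal_prob0_mean s : 0 < s -> (\int[normal_prob 0 s]_x x%:E = 0)%E.
Proof.
move=> s0; set I := (\int[_]_x _)%E.
have iI : (normal_prob 0 s).-integrable setT (@EFin R) by exact: normal_prob_integrable.
have mE : measurable_fun [set: R] (@EFin R) by exact/measurable_EFinP.
(* Invariance of the law under reflection makes the mean its own opposite; being finite, it is
   zero. *)
have IN : I = (- I)%E.
  rewrite -[RHS]integralN.
    transitivity (\int[normal_prob 0 s]_x ((- x)%:E))%E => //.
    have mN : measurable_fun setT (-%R : measurableTypeR R -> measurableTypeR R).
      exact: oppr_measurable.
    have law (A : set (measurableTypeR R)) : measurable A ->
      normal_prob 0 s (-%R @^-1` A) = normal_prob 0 s A.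
      by move=> mA; rewrite normal_prob0N ?gt_eqF.
    apply/esym; apply: (@integral_law _ _ _ (normal_prob 0 s) _ _
      (-%R : measurableTypeR R -> measurableTypeR R) _ mN law (@EFin R)) => //.
    exact: (integrableN iI).
  exact: integrable_add_def.
have : I \is a fin_num by exact: integrable_fin_num.
move: IN; case: I => // r [rN] _; congr (_%:E); lra.
Qed.

End normal_moments.

(** * Fourth moments and noisy contractions *)

Section fourth_moments.
Context d (T : measurableType d) (R : realType) (P : probability T R).
Implicit Types f g : T -> R.

Definition L4 f :=
  measurable_fun setT f /\ P.-integrable setT (EFin \o (fun w => f w ^+ 4)).

Lemma dominated_integrable f g : measurable_fun setT f ->
  P.-integrable setT (EFin \o g) -> (forall w, `|f w| <= g w) ->
  P.-integrable setT (EFin \o f).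
Proof.
move=> mf ig fg; apply: le_integrable ig => //; first exact/measurable_EFinP.
by move=> w _ /=; rewrite lee_fin (le_trans (fg w))// ler_norm.
Qed.

Lemma integrable_EFinD f g : P.-integrable setT (EFin \o f) ->
  P.-integrable setT (EFin \o g) -> P.-integrable setT (EFin \o (fun w => f w + g w)).
Proof. by move=> fi gi; exact: (integrableD measurableT fi gi). Qed.

Lemma integrable_EFinZ (k : R) f : P.-integrable setT (EFin \o f) ->
  P.-integrable setT (EFin \o (fun w => k * f w)).
Proof. by move=> fi; exact: (integrableZl measurableT k fi). Qed.

Lemma integrable_EFin_cst (k : R) : P.-integrable setT (EFin \o (fun=> k)).
Proof. exact: finite_measure_integrable_cst. Qed.

Lemma integrable_EFin_sum (F : nat -> T -> R) n :
  (forall i, (i < n)%N -> P.-integrable setT (EFin \o F i)) ->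
  P.-integrable setT (EFin \o (fun w => \sum_(0 <= i < n) F i w)).
Proof.
elim: n => [|n IH] Fi.
  under [X in EFin \o X]eq_fun do rewrite big_nil.
  exact: integrable_EFin_cst.
under [X in EFin \o X]eq_fun do rewrite big_nat_recr//=.
by apply: integrable_EFinD; [apply: IH => i ni; apply/Fi/ltnW|exact: Fi].
Qed.

Lemma Rintegral_sum (F : nat -> T -> R) n :
  (forall i, (i < n)%N -> P.-integrable setT (EFin \o F i)) ->
  \int[P]_w (\sum_(0 <= i < n) F i w) = \sum_(0 <= i < n) \int[P]_w F i w.
Proof.
elim: n => [|n IH] Fi.
  under eq_Rintegral do rewrite big_nil.
  by rewrite big_nil Rintegral_cst// mul0r.
under eq_Rintegral do rewrite big_nat_recr//=.
rewrite RintegralD//; last exact: Fi.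
  by rewrite IH ?big_nat_recr// => i ni; apply/Fi/ltnW.
by apply: integrable_EFin_sum => i ni; apply/Fi/ltnW.
Qed.

Lemma L4_pow4_ge0 f : 0 <= \int[P]_w (f w ^+ 4).
Proof. by apply: Rintegral_ge0 => w _; exact: pow4_ge0. Qed.

Lemma L4_cst (k : R) : L4 (fun=> k).
Proof. by split => //; exact: integrable_EFin_cst. Qed.

Lemma L4D f g : L4 f -> L4 g -> L4 (fun w => f w + g w).
Proof.
move=> [mf fi] [mg gi]; have mfg : measurable_fun setT (fun w => f w + g w).
  exact: measurable_funD.
split => //; apply: dominated_integrable (integrable_EFinZ 8 (integrable_EFinD fi gi)) _.
  exact: measurable_funX.
by move=> w; rewrite ger0_norm ?pow4_ge0// pow4D_le.
Qed.

Lemma L4Z (k : R) f : L4 f -> L4 (fun w => k * f w).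
Proof.
move=> [mf fi]; split; first by apply: measurable_funM.
under [X in EFin \o X]eq_fun do rewrite exprMn.
exact: integrable_EFinZ.
Qed.

Lemma L4_sum (F : nat -> T -> R) n : (forall i, (i < n)%N -> L4 (F i)) ->
  L4 (fun w => \sum_(0 <= i < n) F i w).
Proof.
elim: n => [|n IH] FL.
  under eq_fun do rewrite big_nil.
  exact: L4_cst.
under eq_fun do rewrite big_nat_recr//=.
by apply: L4D; [apply: IH => i ni; apply/FL/ltnW|exact: FL].
Qed.

Lemma L4_dominated f g : measurable_fun setT f -> L4 g ->
  (forall w, `|f w| <= `|g w|) -> L4 f.
Proof.
move=> mf [mg gi] fg; split => //.
apply: dominated_integrable gi _; first exact: measurable_funX.
move=> w; rewrite normrX -[leRHS]ger0_norm ?pow4_ge0// normrX.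
by rewrite lerXn2r// nnegrE.
Qed.

(** Young's inequality gives the dominating function. Putting the constant 1 for one of the two
    factors yields the integrability of [f ^+ 3] and of [f]. *)
Lemma L4_mul3_integrable f g : L4 f -> L4 g ->
  P.-integrable setT (EFin \o (fun w => f w ^+ 3 * g w)).
Proof.
move=> [mf fi] [mg gi]; apply: dominated_integrable (integrable_EFinD fi gi) _.
  by apply: measurable_funM => //; exact: measurable_funX.
by move=> w; exact: young3_le.
Qed.

Lemma L4_pow3_integrable f : L4 f -> P.-integrable setT (EFin \o (fun w => f w ^+ 3)).
Proof.
move=> Lf; have := L4_mul3_integrable Lf (L4_cst 1).
by under [X in EFin \o X]eq_fun do rewrite mulr1.
Qed.

Lemma L4_integrable f : L4 f -> P.-integrable setT (EFin \o f).
Proof.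
move=> Lf; have := L4_mul3_integrable (L4_cst 1) Lf.
by under [X in EFin \o X]eq_fun do rewrite expr1n mul1r.
Qed.

(** * Fourth moments along a noisy contraction *)

Section contraction.
Variables (e Z : nat -> T -> R) (u z : R).
Hypothesis u01 : 0 < u <= 1.
Hypothesis eS : forall k w, e k.+1 w = (1 - u) * e k w + Z k w.
Hypothesis e0L : L4 (e 0%N).
Hypothesis ZL : forall k, L4 (Z k).
Hypothesis Zz : forall k, \int[P]_w (Z k w ^+ 4) <= z.
Hypothesis eZ0 : forall k, \int[P]_w (e k w ^+ 3 * Z k w) = 0.

Lemma contraction_L4 k : L4 (e k).
Proof.
elim: k => // k IH; have -> : e k.+1 = (fun w => (1 - u) * e k w + Z k w).
  by apply/funext => w; rewrite eS.
by apply: L4D; [exact: L4Z|exact: ZL].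
Qed.

(** The quartic inequality is taken with [d = u / 2]. The cross term integrates to zero,
    [(1 - u) ^+ 4 <= 1 - u] leaves the factor [1 - u / 2], and [19 / d] becomes [38 / u]. *)
Lemma contraction_step k :
  \int[P]_w (e k.+1 w ^+ 4) <= (1 - u / 2) * \int[P]_w (e k w ^+ 4) + 38 / u * z.
Proof.
have [u0 u1] := andP u01.
have [mek iek] := contraction_L4 k; have [mek1 iek1] := contraction_L4 k.+1.
have [mZ iZ] := ZL k; have ieZ := L4_mul3_integrable (contraction_L4 k) (ZL k).
have a01 : 0 <= 1 - u <= 1 by apply/andP; split; lra.
have d01 : 0 < u / 2 <= 1 by apply/andP; split; lra.
set c1 := (1 - u) ^+ 4 + u / 2; set c2 := 4 * (1 - u) ^+ 3; set c3 := 19 / (u / 2).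
apply: (@le_trans _ _ (\int[P]_w (c1 * e k w ^+ 4 + c2 * (e k w ^+ 3 * Z k w)
   + c3 * Z k w ^+ 4))).
  apply: le_Rintegral => //.
    apply: integrable_EFinD; last exact: integrable_EFinZ.
    by apply: integrable_EFinD; exact: integrable_EFinZ.
  by move=> w _; rewrite eS pow4_contraction_le.
rewrite RintegralD//; last 2 first.
- by apply: integrable_EFinD; exact: integrable_EFinZ.
- exact: integrable_EFinZ.
rewrite RintegralD//; try exact: integrable_EFinZ.
rewrite !RintegralZl// eZ0 mulr0 addr0.
have -> : c3 = 38 / u by rewrite /c3; field; rewrite gt_eqF.
rewrite lerD//; last by rewrite ler_pM2l ?divr_gt0.
rewrite ler_wpM2r ?L4_pow4_ge0// /c1.
have : (1 - u) ^+ 4 <= 1 - u.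
  by rewrite exprS ler_piMr ?exprn_ile1//; case/andP: a01.
lra.
Qed.

Lemma contraction_sum_pow4_le M :
  \sum_(0 <= j < M) \int[P]_w (e j w ^+ 4) <=
  2 / u * (\int[P]_w (e 0%N w ^+ 4) + M%:R * (38 / u * z)).
Proof.
have [u0 u1] := andP u01.
(* The one-step bound telescopes; keeping the final moment on the right is what makes the induction
   go through. *)
suff H : u / 2 * (\sum_(0 <= j < M) \int[P]_w (e j w ^+ 4)) <=
  \int[P]_w (e 0%N w ^+ 4) + M%:R * (38 / u * z) - \int[P]_w (e M w ^+ 4).
  have := L4_pow4_ge0 (e M).
  have -> : 2 / u = (u / 2)^-1 by rewrite invf_div.
  by move=> eM; rewrite ler_pdivlMl ?divr_gt0// (le_trans H)// gerBl.
elim: M => [|M IH]; first by rewrite big_nil mulr0 mul0r addr0 subrr.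
rewrite big_nat_recr//= mulrDr.
have -> : M.+1%:R = M%:R + 1 :> R by rewrite natr1.
have := contraction_step M; lra.
Qed.

End contraction.
End fourth_moments.

(** * The SGLD error process *)

(** Turns evaluation at a random index into a finite sum of indicators. The shift reflects data
    numbered from 1, and an index out of range selects 0. *)
Lemma sum_indicator_mul (R : realType) (N t : nat) (F : nat -> R) :
  \sum_(0 <= i < N) (t == i.+1)%:R * F i = if (1 <= t <= N)%N then F t.-1 else 0.
Proof.
elim: N => [|N IH]; first by rewrite big_nil; case: t.
rewrite big_nat_recr//= IH; have [->|tN] := eqVneq t N.+1.
  by rewrite ltnn leqnn /= add0r mul1r.
by rewrite mul0r addr0 [(t <= N.+1)%N]leq_eqVlt (negbTE tN)/=.
Qed.

Section sgld.
Context d (T : measurableType d) (R : realType) (P : probability T R).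
Variables (st sx h : R) (N : nat).
Variables (X : nat -> T -> R) (tau : nat -> T -> nat) (xi : nat -> T -> R).
Hypotheses (st0 : 0 < st) (sx0 : 0 < sx) (h0 : 0 < h) (N0 : (0 < N)%N).
Hypothesis mX : forall i, measurable_fun setT (X i).
Hypothesis mxi : forall k, measurable_fun setT (xi k).
Hypothesis mtau : forall k i, measurable (tau k @^-1` [set i]).
Hypothesis lawX : forall i, (1 <= i <= N)%N ->
  forall B, measurable B -> P (X i @^-1` B) = normal_prob 1 sx B.
Hypothesis lawtau : forall k i, (1 <= i <= N)%N ->
  P (tau k @^-1` [set i]) = (N%:R^-1)%:E.
Hypothesis lawxi : forall k B, measurable B -> P (xi k @^-1` B) = normal_prob 0 1 B.
Hypothesis indep : mutually_independent P (sgld_valid N) (sgld_sigma X tau xi).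

Local Notation F := (sgld_sigma X tau xi).
Local Notation S := (sgld_valid N).
Local Notation mu := (post_mean st sx N X).
Local Notation u := (sgld_A st sx N * h).

Let N0' : 0 < N%:R :> R. Proof. by rewrite ltr0n. Qed.

Lemma measurable_tau k (B : set nat) : measurable (tau k @^-1` B).
Proof.
rewrite (_ : _ @^-1` _ = \bigcup_(i in B) (tau k @^-1` [set i])).
  by apply: bigcup_measurable => i _; exact: mtau.
by apply/seteqP; split => [w Bw|w [i Bi tw]]; [exists (tau k w)|rewrite /preimage/= tw].
Qed.

Lemma sgld_sigmaT i : F i setT.
Proof.
by case: i => [[i|k]|k] /=; exists setT; rewrite ?preimage_setT.
Qed.

Lemma sgld_sigmaI i : setI_closed (F i).
Proof.
case: i => [[i|k]|k] A B /=.
- by move=> [A' mA ->] [B' mB ->]; exists (A' `&` B'); [exact: measurableI|].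
- by move=> [A' ->] [B' ->]; exists (A' `&` B').
- by move=> [A' mA ->] [B' mB ->]; exists (A' `&` B'); [exact: measurableI|].
Qed.

Lemma sgld_sigma_measurable i : S i -> F i `<=` measurable.
Proof.
case: i => [[i|k]|k] _ A /=.
- by move=> [B mB ->]; rewrite -[_ @^-1` _]setTI; exact: mX.
- by move=> [B ->]; exact: measurable_tau.
- by move=> [B mB ->]; rewrite -[_ @^-1` _]setTI; exact: mxi.
Qed.

(** All the data belong to the past from the start, because the error begins at [- mu]. The inputs
    [tau k] and [xi k] of step [k] are still fresh. *)
Definition sgld_past k : seq sgld_index :=
  [seq inl (inl i) | i <- iota 1 N] ++
  [seq inl (inr l) | l <- iota 0 k] ++ [seq inr l | l <- iota 0 k].

Lemma mem_sgld_past k j : (j \in sgld_past k) =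
  match j with
  | inl (inl i) => (1 <= i <= N)%N
  | inl (inr l) => (l < k)%N
  | inr l => (l < k)%N
  end.
Proof.
have inj1 : injective (fun i : nat => inl (inl i) : sgld_index) by move=> ? ? [].
have inj2 : injective (fun i : nat => inl (inr i) : sgld_index) by move=> ? ? [].
have inj3 : injective (fun i : nat => inr i : sgld_index) by move=> ? ? [].
rewrite !mem_cat; case: j => [[i|l]|l].
- rewrite (mem_map inj1) mem_iota add1n ltnS.
  by rewrite !(introF mapP) ?orbF// => -[].
- rewrite (mem_map inj2) mem_iota add0n /=.
  by rewrite !(introF mapP) ?orbF// => -[].
- rewrite (mem_map inj3) mem_iota add0n /=.
  by rewrite !(introF mapP)// => -[].
Qed.

Lemma sgld_past_uniq k : uniq (sgld_past k).
Proof.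
have inj1 : injective (fun i : nat => inl (inl i) : sgld_index) by move=> ? ? [].
have inj2 : injective (fun i : nat => inl (inr i) : sgld_index) by move=> ? ? [].
have inj3 : injective (fun i : nat => inr i : sgld_index) by move=> ? ? [].
rewrite !cat_uniq !map_inj_uniq// !iota_uniq /= andbT; apply/andP; split.
  by apply/hasPn => j; rewrite mem_cat => /orP[] /mapP[i _ ->];
    apply/mapP => -[].
by apply/hasPn => j /mapP[i _ ->]; apply/mapP => -[].
Qed.

Lemma sgld_past_valid k : {subset sgld_past k <= S}.
Proof. by move=> j; rewrite mem_sgld_past; case: j => [[]|]. Qed.

Local Notation G k := (g_sigma_algebraType (cylinders F (sgld_past k))).

Lemma measurable_past k t (W : T -> R) : t \in sgld_past k ->
  (forall B, measurable B -> F t (W @^-1` B)) ->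
  measurable_fun setT (W : G k -> R).
Proof.
move=> tk FW _ B mB; rewrite setTI; apply: sub_sigma_algebra.
by apply: (sub_cylinders sgld_sigmaT tk); exact: FW.
Qed.

Definition tau_dev k i w : R := (tau k w == i)%:R - N%:R^-1.

Lemma tau_dev_sigma k i B : F (inl (inr k)) (tau_dev k i @^-1` B).
Proof. by exists [set l : nat | B ((l == i)%:R - N%:R^-1)]. Qed.

(** The drawn observation minus the empirical mean, for an index in range. As a sum, each term
    splits into a fresh centred factor and a datum from the past, which [X (tau k w) w] does not
    show. *)
Definition draw_dev k w := \sum_(0 <= i < N) tau_dev k i.+1 w * X i.+1 w.

Definition sgld_noise k w :=
  h * (2 * sx ^+ 2)^-1 * N%:R * draw_dev k w + Num.sqrt h * xi k w.

(** Given by its own recursion rather than as a difference, so that its measurability with respect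
    to the past and its moments hold without assuming indices in range. *)
Fixpoint sgld_err k w : R :=
  if k is l.+1 then (1 - u) * sgld_err l w + sgld_noise l w else - mu w.

Lemma post_meanE w : mu w = (\sum_(0 <= i < N) X i.+1 w) / (sx ^+ 2 / st ^+ 2 + N%:R).
Proof. by rewrite /post_mean big_add1. Qed.

Lemma draw_devE k w : (1 <= tau k w <= N)%N ->
  draw_dev k w = X (tau k w) w - (\sum_(0 <= i < N) X i.+1 w) / N%:R.
Proof.
move=> tN; rewrite /draw_dev; under eq_bigr do rewrite mulrBl.
rewrite sumrB sum_indicator_mul tN; case/andP: tN => t1 _; rewrite prednK//.
by rewrite mulrC mulr_sumr.
Qed.

(** The posterior mean is the fixed point of the averaged recursion: [sgld_A st sx N * mu w] is the
    sum of the data over [2 * sx ^+ 2]. *)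
Lemma sgld_theta_err k w : (forall l, (1 <= tau l w <= N)%N) ->
  sgld_theta st sx N h X tau xi k w = sgld_err k w + mu w.
Proof.
move=> tN; elim: k => [|k IH] /=; first by rewrite addNr.
rewrite IH /sgld_noise draw_devE// post_meanE /sgld_A.
field; rewrite !gt_eqF//= addr_gt0// mulr_gt0 ?exprn_gt0//.
Qed.

Lemma X_measurable_past k i : (1 <= i <= N)%N -> measurable_fun setT (X i : G k -> R).
Proof.
move=> iN; apply: (@measurable_past k (inl (inl i))); first by rewrite mem_sgld_past.
by move=> B mB; exists B.
Qed.

(** Having [j] below a fixed [k] lets the induction on [j] stay inside a single sigma-algebra. *)
Lemma sgld_err_measurable_past j k : (j <= k)%N ->
  measurable_fun setT (sgld_err j : G k -> R).
Proof.
have msum n (Y : nat -> G k -> R) :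
    (forall i, (i < n)%N -> measurable_fun setT (Y i)) ->
    measurable_fun setT (fun w => \sum_(0 <= i < n) Y i w).
  elim: n => [|n IH] mY.
    by rewrite (_ : (fun w => _) = cst 0)//; apply/funext => w; rewrite big_nil.
  under eq_fun do rewrite big_nat_recr//=.
  apply: measurable_funD; first by apply: IH => i ni; apply: mY; exact: ltnW.
  exact: mY.
elim: j => [_|j IH jk].
  rewrite [X in measurable_fun _ X](_ : _ = fun w : G k =>
     - (sx ^+ 2 / st ^+ 2 + N%:R)^-1 * (\sum_(0 <= i < N) X i.+1 w)); last first.
    by apply/funext => w /=; rewrite post_meanE mulrC mulNr.
  by apply: measurable_funM => //; apply: msum => i iN; exact: X_measurable_past.
apply: measurable_funD.
  by apply: measurable_funM => //; apply: IH; exact: ltnW.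
apply: measurable_funD; apply: measurable_funM => //; last first.
  apply: (@measurable_past k (inr j)); first by rewrite mem_sgld_past.
  by move=> B mB; exists B.
apply: msum => i iN; apply: measurable_funM; last exact: X_measurable_past.
apply: (@measurable_past k (inl (inr j))); first by rewrite mem_sgld_past.
by move=> B mB; exact: tau_dev_sigma.
Qed.

Lemma tau_dev_measurable k i : measurable_fun setT (tau_dev k i).
Proof.
move=> _ B mB; rewrite setTI.
exact: (@sgld_sigma_measurable (inl (inr k)) isT _ (tau_dev_sigma k i B)).
Qed.

Lemma normr_tau_dev_le1 k i w : `|tau_dev k i w| <= 1.
Proof.
rewrite /tau_dev; have n1 : N%:R^-1 <= 1 :> R by rewrite invf_le1// ler1n.
have n0 : 0 <= N%:R^-1 :> R by rewrite invr_ge0.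
by case: (_ == _) => /=; rewrite ler_norml; apply/andP; split; lra.
Qed.

Lemma tau_dev_integrable k i : P.-integrable setT (EFin \o tau_dev k i).
Proof.
apply: dominated_integrable (integrable_EFin_cst P 1) _.
  exact: tau_dev_measurable.
exact: normr_tau_dev_le1.
Qed.

Lemma tau_dev_mean k i : (1 <= i <= N)%N -> \int[P]_w tau_dev k i w = 0.
Proof.
move=> iN; rewrite /tau_dev.
have E : (fun w => (tau k w == i)%:R : R) = \1_(tau k @^-1` [set i]).
  apply/funext => w; rewrite indicE.
  by case: eqP => tw; [rewrite mem_set|rewrite memNset].
rewrite RintegralB//; last 2 first.
- rewrite -/(EFin \o _) E; exact: integrable_indic.
- exact: integrable_EFin_cst.
have PT : fine (P setT) = 1 by rewrite probability_setT.
rewrite Rintegral_cst// [fine _]PT.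
rewrite mulr1 E /Rintegral integral_indic//.
have Pi : fine (P (tau k @^-1` [set i] `&` setT)) = N%:R^-1 by rewrite setIT lawtau.
by rewrite [fine _]Pi subrr.
Qed.

Lemma past_mul_tau_dev0 k i (Y : G k -> R) : (1 <= i <= N)%N ->
  measurable_fun setT Y -> P.-integrable setT (EFin \o (Y : T -> R)) ->
  \int[P]_w ((Y : T -> R) w * tau_dev k i w) = 0.
Proof.
move=> iN mY iY.
have mYT := generated_measurable_fun sgld_sigma_measurable (@sgld_past_valid k) mY.
apply: (independent_past_mul0 sgld_sigmaT sgld_sigmaI sgld_sigma_measurable indep
  (sgld_past_uniq k) (@sgld_past_valid k) (t := inl (inr k)) _ _ mY) => //.
- by rewrite mem_sgld_past ltnn.
- exact: tau_dev_measurable.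
- by move=> B mB; exact: tau_dev_sigma.
- exact: tau_dev_integrable.
- apply: (dominated_integrable (g := fun w => `|(Y : T -> R) w|)).
  + by apply: measurable_funM => //; exact: tau_dev_measurable.
  + exact: integrable_norm.
  + by move=> w; rewrite normrM ler_piMr// normr_tau_dev_le1.
- exact: tau_dev_mean.
Qed.

Lemma past_mul_xi0 k (Y : G k -> R) : measurable_fun setT Y ->
  P.-integrable setT (EFin \o (Y : T -> R)) ->
  P.-integrable setT (EFin \o xi k) ->
  P.-integrable setT (EFin \o (fun w => (Y : T -> R) w * xi k w)) ->
  \int[P]_w ((Y : T -> R) w * xi k w) = 0.
Proof.
move=> mY iY ixi iYxi.
apply: (independent_past_mul0 sgld_sigmaT sgld_sigmaI sgld_sigma_measurable indep
  (sgld_past_uniq k) (@sgld_past_valid k) (t := inr k) _ _ mY) => //.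
- by rewrite mem_sgld_past ltnn.
- by move=> B mB; exists B.
- have mE : measurable_fun [set: R] (@EFin R) by exact/measurable_EFinP.
  by rewrite /Rintegral (@integral_law _ _ _ P _ (measurableTypeR R) (xi k)
      (normal_prob 0 1) (mxi k) (lawxi k) _ mE)// normal_prob0_mean.
Qed.

(** * Fourth moments of the data, the noise and the posterior mean *)

Local Notation m4X := (\int[normal_prob 1 sx]_x (x ^+ 4)).
Local Notation m4xi := (\int[normal_prob 0 1]_x (x ^+ 4)).

Lemma X_L4 i : (1 <= i <= N)%N -> L4 P (X i).
Proof.
move=> iN; split => //.
have mE : measurable_fun [set: R] (fun x => (x ^+ 4)%:E).
  by apply/measurable_EFinP; exact: measurable_funX.
apply/(@integrable_lawP _ _ _ P _ (measurableTypeR R) (X i)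
  (normal_prob 1 sx) (mX i) (lawX iN) _ mE).
exact: normal_prob_integrable_pow4.
Qed.

Lemma X_moment4 i : (1 <= i <= N)%N -> \int[P]_w (X i w ^+ 4) = m4X.
Proof.
move=> iN; rewrite /Rintegral.
have mE : measurable_fun [set: R] (fun x => (x ^+ 4)%:E).
  by apply/measurable_EFinP; exact: measurable_funX.
rewrite (@ge0_integral_law _ _ _ P _ (measurableTypeR R) (X i)
  (normal_prob 1 sx) (mX i) (lawX iN) _ mE)// => x.
by rewrite lee_fin pow4_ge0.
Qed.

Lemma xi_L4 k : L4 P (xi k).
Proof.
split => //.
have mE : measurable_fun [set: R] (fun x => (x ^+ 4)%:E).
  by apply/measurable_EFinP; exact: measurable_funX.
apply/(@integrable_lawP _ _ _ P _ (measurableTypeR R) (xi k)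
  (normal_prob 0 1) (mxi k) (lawxi k) _ mE).
exact: normal_prob_integrable_pow4.
Qed.

Lemma xi_moment4 k : \int[P]_w (xi k w ^+ 4) = m4xi.
Proof.
rewrite /Rintegral.
have mE : measurable_fun [set: R] (fun x => (x ^+ 4)%:E).
  by apply/measurable_EFinP; exact: measurable_funX.
rewrite (@ge0_integral_law _ _ _ P _ (measurableTypeR R) (xi k)
  (normal_prob 0 1) (mxi k) (lawxi k) _ mE)// => x.
by rewrite lee_fin pow4_ge0.
Qed.

Let ordN i : (i < N)%N -> (1 <= i.+1 <= N)%N. Proof. by []. Qed.

Lemma mean_pow4X :
  \int[P]_w ((\sum_(0 <= i < N) X i.+1 w ^+ 4) / N%:R) = m4X /\
  P.-integrable setT (EFin \o (fun w => (\sum_(0 <= i < N) X i.+1 w ^+ 4) / N%:R)).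
Proof.
have iX i : (i < N)%N -> P.-integrable setT (EFin \o (fun w => X i.+1 w ^+ 4)).
  by move=> /ordN/X_L4[].
have iS := integrable_EFin_sum iX.
split; last first.
  under [X in EFin \o X]eq_fun do rewrite mulrC.
  exact: integrable_EFinZ.
rewrite RintegralZr// Rintegral_sum//.
rewrite (eq_big_nat _ _ (F2 := fun=> m4X)); last first.
  by move=> i /andP[_ iN]; rewrite X_moment4.
by rewrite sumr_const_nat subn0 -(mulr_natr m4X) mulfK// gt_eqF.
Qed.

Lemma tau_dev_mul_L4 k i : (1 <= i <= N)%N -> L4 P (fun w => tau_dev k i w * X i w).
Proof.
move=> iN; apply: L4_dominated (X_L4 iN) _.
  by apply: measurable_funM => //; exact: tau_dev_measurable.
by move=> w; rewrite normrM ler_piMl// normr_tau_dev_le1.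
Qed.

Lemma draw_dev_L4 k : L4 P (draw_dev k).
Proof. by apply: L4_sum => i /ordN; exact: tau_dev_mul_L4. Qed.

Lemma sgld_noise_L4 k : L4 P (sgld_noise k).
Proof. by apply: L4D; apply: L4Z; [exact: draw_dev_L4|exact: xi_L4]. Qed.

(** The prior only enlarges the denominator, so the posterior mean is dominated by the empirical
    mean, to which Jensen applies. *)
Lemma post_mean_pow4_le w : mu w ^+ 4 <= (\sum_(0 <= i < N) X i.+1 w ^+ 4) / N%:R.
Proof.
apply: le_trans (pow4_mean_le (fun i => X i.+1 w) N0).
rewrite post_meanE !expr_div_n ler_wpM2l ?pow4_ge0//.
have r0 : 0 <= sx ^+ 2 / st ^+ 2 by rewrite divr_ge0// sqr_ge0.
rewrite lef_pV2 ?posrE ?exprn_gt0//; last by rewrite ltr_wpDl.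
by rewrite lerXn2r ?nnegrE ?addr_ge0// lerDr.
Qed.

Lemma post_mean_L4 : L4 P mu.
Proof.
have -> : mu = fun w => (sx ^+ 2 / st ^+ 2 + N%:R)^-1 * (\sum_(0 <= i < N) X i.+1 w).
  by apply/funext => w; rewrite post_meanE mulrC.
by apply: L4Z; apply: L4_sum => i /ordN; exact: X_L4.
Qed.

Lemma post_mean_moment4 : \int[P]_w (mu w ^+ 4) <= m4X.
Proof.
have [<- iS] := mean_pow4X.
by apply: le_Rintegral => //; [case: post_mean_L4|move=> w _; exact: post_mean_pow4_le].
Qed.

(** The bound is linear in the centred indicators, so their contribution vanishes in expectation and
    only the empirical fourth moment remains. *)
Lemma draw_dev_pow4_le k w : draw_dev k w ^+ 4 <=
  8 * ((\sum_(0 <= i < N) X i.+1 w ^+ 4 * tau_dev k i.+1 w) +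
       2 * ((\sum_(0 <= i < N) X i.+1 w ^+ 4) / N%:R)).
Proof.
pose D := \sum_(0 <= i < N) (tau k w == i.+1)%:R * X i.+1 w.
have -> : draw_dev k w = D + - ((\sum_(0 <= i < N) X i.+1 w) / N%:R).
  rewrite /draw_dev /tau_dev; under eq_bigr do rewrite mulrBl.
  by rewrite sumrB -/D [in RHS]mulrC mulr_sumr.
apply: le_trans (pow4D_le _ _) _; rewrite ler_pM2l//.
(* At most one indicator is nonzero, so selecting a datum commutes with taking its fourth power. *)
have -> : \sum_(0 <= i < N) X i.+1 w ^+ 4 * tau_dev k i.+1 w =
    D ^+ 4 - (\sum_(0 <= i < N) X i.+1 w ^+ 4) / N%:R.
  rewrite /tau_dev; under eq_bigr do rewrite mulrBr [_ * (_ == _)%:R]mulrC.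
  rewrite sumrB -mulr_suml; congr (_ - _).
  by rewrite /D !sum_indicator_mul; case: ifP => _ //; rewrite expr0n.
have := pow4_mean_le (fun i => X i.+1 w) N0.
have -> : (- ((\sum_(0 <= i < N) X i.+1 w) / N%:R)) ^+ 4 =
  ((\sum_(0 <= i < N) X i.+1 w) / N%:R) ^+ 4 by ring.
lra.
Qed.

Lemma draw_dev_moment4 k : \int[P]_w (draw_dev k w ^+ 4) <= 16 * m4X.
Proof.
have [mS iS] := mean_pow4X.
have iXD i : (i < N)%N ->
    P.-integrable setT (EFin \o (fun w => X i.+1 w ^+ 4 * tau_dev k i.+1 w)).
  move=> /ordN iN; have [_ iX] := X_L4 iN; apply: dominated_integrable iX _.
    by apply: measurable_funM; [exact: measurable_funX|exact: tau_dev_measurable].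
  move=> w; rewrite normrM [`|_ ^+ 4|]ger0_norm ?pow4_ge0//.
  by rewrite ler_piMr ?pow4_ge0// normr_tau_dev_le1.
have iSD := integrable_EFin_sum iXD.
apply: le_trans (le_Rintegral measurableT (draw_dev_L4 k).2 _
  (fun w _ => draw_dev_pow4_le k w)) _.
  by apply: integrable_EFinZ; apply: integrable_EFinD => //; exact: integrable_EFinZ.
rewrite RintegralZl//; last by apply: integrable_EFinD => //; exact: integrable_EFinZ.
rewrite RintegralD//; last exact: integrable_EFinZ.
rewrite RintegralZl// mS Rintegral_sum// big_nat big1; first lra.
move=> i /ordN iN.
apply: (@past_mul_tau_dev0 k i.+1 (fun w => X i.+1 w ^+ 4)) => //.
  by apply: measurable_funX; exact: X_measurable_past.
by case: (X_L4 iN).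
Qed.

Definition noise_bound :=
  8 * ((h * (2 * sx ^+ 2)^-1 * N%:R) ^+ 4 * (16 * m4X) + h ^+ 2 * m4xi).

Lemma sgld_noise_moment4 k : \int[P]_w (sgld_noise k w ^+ 4) <= noise_bound.
Proof.
set al := h * (2 * sx ^+ 2)^-1 * N%:R.
have iD := (draw_dev_L4 k).2; have ixi := (xi_L4 k).2.
apply: (@le_trans _ _ (\int[P]_w
    (8 * (al ^+ 4 * draw_dev k w ^+ 4 + h ^+ 2 * xi k w ^+ 4)))).
  apply: le_Rintegral => //; first exact: (sgld_noise_L4 k).2.
    by apply: integrable_EFinZ; apply: integrable_EFinD; exact: integrable_EFinZ.
  move=> w _; apply: le_trans (pow4D_le _ _) _.
  have -> : h ^+ 2 = Num.sqrt h ^+ 4 by rewrite (exprM _ 2 2) sqr_sqrtr// ltW.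
  by rewrite -/al !exprMn.
rewrite RintegralZl//; last by apply: integrable_EFinD; exact: integrable_EFinZ.
rewrite RintegralD//; try exact: integrable_EFinZ.
rewrite !RintegralZl// xi_moment4 /noise_bound -/al ler_pM2l// lerD2r.
by rewrite ler_wpM2l ?pow4_ge0// draw_dev_moment4.
Qed.

Lemma sgld_err_L4 k : L4 P (sgld_err k).
Proof.
elim: k => [|k IH].
  have := L4Z (-1) post_mean_L4; congr L4; apply/funext => w /=; exact: mulN1r.
by apply: L4D; [exact: L4Z|exact: sgld_noise_L4].
Qed.

Lemma sgld_err_noise0 k : \int[P]_w (sgld_err k w ^+ 3 * sgld_noise k w) = 0.
Proof.
set al := h * (2 * sx ^+ 2)^-1 * N%:R.
have Le := sgld_err_L4 k.
have me := @sgld_err_measurable_past k k (leqnn k).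
have iD i : (i < N)%N -> P.-integrable setT
    (EFin \o (fun w => sgld_err k w ^+ 3 * (tau_dev k i.+1 w * X i.+1 w))).
  by move=> /ordN iN; apply: L4_mul3_integrable => //; exact: tau_dev_mul_L4.
have ixi := L4_mul3_integrable Le (xi_L4 k).
rewrite (eq_Rintegral _ _ (g := fun w =>
   al * (\sum_(0 <= i < N) sgld_err k w ^+ 3 * (tau_dev k i.+1 w * X i.+1 w)) +
   Num.sqrt h * (sgld_err k w ^+ 3 * xi k w))); last first.
  by move=> w _; rewrite /sgld_noise -/al /draw_dev -mulr_sumr; ring.
rewrite RintegralD//; last 2 first.
- by apply: integrable_EFinZ; exact: integrable_EFin_sum.
- exact: integrable_EFinZ.
rewrite !RintegralZl//; last exact: integrable_EFin_sum.
rewrite (@past_mul_xi0 k (fun w => sgld_err k w ^+ 3))//; last 3 first.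
- exact: measurable_funX.
- exact: L4_pow3_integrable.
- exact/L4_integrable/xi_L4.
rewrite Rintegral_sum// big_nat big1 ?mulr0 ?addr0// => i /ordN iN.
(* The datum joins the cube of the error on the side of the past, leaving [tau_dev] as the only
   fresh factor. *)
rewrite (eq_Rintegral _ _ (g := fun w =>
    sgld_err k w ^+ 3 * X i.+1 w * tau_dev k i.+1 w)).
  apply: (@past_mul_tau_dev0 k i.+1 (fun w => sgld_err k w ^+ 3 * X i.+1 w)) => //.
    by apply: measurable_funM; [exact: measurable_funX|exact: X_measurable_past].
  by apply: L4_mul3_integrable => //; exact: X_L4.
by move=> w _; ring.
Qed.

(** The law of [tau k] is prescribed only on the indices from 1 to [N], but these [N] masses already
    sum to 1. This is read off from the zero mean of the sum of the [tau_dev]. *)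
Lemma tau_range_ae : {ae P, forall w, forall k, (1 <= tau k w <= N)%N}.
Proof.
apply/ae_foralln => k.
pose A := tau k @^-1` [set t : nat | (1 <= t <= N)%N].
have mA : measurable A by exact: measurable_tau.
have E w : \sum_(0 <= i < N) tau_dev k i.+1 w = \1_A w - 1.
  rewrite /tau_dev sumrB sumr_const_nat subn0 -(mulr_natr N%:R^-1) mulVf ?gt_eqF//.
  congr (_ - _); under eq_bigr do rewrite -[_%:R]mulr1.
  rewrite (sum_indicator_mul N (tau k w) (fun=> 1)) indicE.
  by case: ifP => tN; [rewrite mem_set|rewrite memNset// /A /= tN].
have PA : P A = 1%E.
  have : \int[P]_w (\sum_(0 <= i < N) tau_dev k i.+1 w) = 0.
    rewrite Rintegral_sum; last by move=> i _; exact: tau_dev_integrable.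
    by rewrite big_nat big1// => i /ordN iN; exact: tau_dev_mean.
  under eq_Rintegral do rewrite E.
  rewrite RintegralB//; last 2 first.
  - exact: integrable_indic.
  - exact: integrable_EFin_cst.
  have PT : fine (P setT) = 1 by rewrite probability_setT.
  rewrite Rintegral_cst// [fine _]PT mul1r /Rintegral integral_indic// setIT.
  move=> /eqP; rewrite subr_eq0 => /eqP PA1.
  by rewrite -[LHS]fineK ?fin_num_measure// [fine _]PA1.
exists (~` A); split; first exact: measurableC.
  have PC : P (~` A) = 0%E by rewrite probability_setC// PA subee.
  exact: PC.
by move=> w /= ntw Aw; exact: ntw.
Qed.

Lemma sgld_theta_measurable k : measurable_fun setT (sgld_theta st sx N h X tau xi k).
Proof.
elim: k => [|k IH] /=; first exact: measurable_cst.
apply: measurable_funD; last by apply: measurable_funM.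
apply: measurable_funD; first by apply: measurable_funM.
apply: measurable_funM => //; apply: measurable_funM => //; apply: measurable_funM => //.
move=> _ B mB; rewrite setTI.
(* The event is cut according to the countably many values of the random index. *)
rewrite (_ : _ @^-1` _ = \bigcup_i (tau k @^-1` [set i] `&` X i @^-1` B)).
  apply: bigcup_measurable => i _; apply: measurableI; first exact: mtau.
  by rewrite -[_ @^-1` _]setTI; exact: mX.
by apply/seteqP; split => [w Bw|w [i _ [/= <-]]//]; exists (tau k w).
Qed.

(** Jensen over the steps and [sqr_dev_le] give a pointwise bound, whose expectation is controlled
    by the contraction estimate. The weight [s] stays free and is tuned to the rate at the end. *)
Lemma sgld_mean_square_error_le M (s : R) : 0 < u <= 1 -> (0 < M)%N -> 0 < s ->
  (\int[P]_w (((\sum_(0 <= j < M) sgld_theta st sx N h X tau xi j w ^+ 2) / M%:R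
     - (mu w ^+ 2 + post_var st sx N)) ^+ 2)%:E <=
   (3 * ((1 + s^-1) * (2 / u * (m4X + M%:R * (38 / u * noise_bound)) / M%:R)
         + 4 * s * m4X + post_var st sx N ^+ 2))%:E)%E.
Proof.
move=> u01 M0 s0; set v := post_var st sx N.
have M0' : 0 < M%:R :> R by rewrite ltr0n.
have [mmu imu] := post_mean_L4.
pose g w := 3 * ((1 + s^-1) * ((\sum_(0 <= j < M) sgld_err j w ^+ 4) / M%:R)
     + 4 * s * mu w ^+ 4 + v ^+ 2).
have ie j : (j < M)%N -> P.-integrable setT (EFin \o (fun w => sgld_err j w ^+ 4)).
  by move=> _; exact: (sgld_err_L4 j).2.
have iS : P.-integrable setT
    (EFin \o (fun w => (\sum_(0 <= j < M) sgld_err j w ^+ 4) / M%:R)).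
  under [X in EFin \o X]eq_fun do rewrite mulrC.
  by apply: integrable_EFinZ; exact: integrable_EFin_sum.
have i12 := integrable_EFinD (integrable_EFinZ (1 + s^-1) iS)
  (integrable_EFinZ (4 * s) imu).
have i123 := integrable_EFinD i12 (integrable_EFin_cst P (v ^+ 2)).
have ig : P.-integrable setT (EFin \o g) by exact: integrable_EFinZ.
apply: (@le_trans _ _ (\int[P]_w (g w)%:E)%E).
  apply: ae_ge0_le_integral => //.
  - by move=> w _; rewrite lee_fin sqr_ge0.
  - apply/measurable_EFinP; apply: measurable_funX; apply: measurable_funB.
      apply: measurable_funM => //; apply: measurable_sum => j.
      by apply: measurable_funX; exact: sgld_theta_measurable.
    by apply: measurable_funD => //; exact: measurable_funX.
  - move=> w _; rewrite lee_fin mulr_ge0// addr_ge0 ?sqr_ge0//.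
    rewrite addr_ge0// mulr_ge0 ?pow4_ge0//; last by rewrite mulr_ge0// ltW.
      by rewrite addr_ge0// invr_ge0 ltW.
    by rewrite divr_ge0// sumr_ge0// => j _; exact: pow4_ge0.
  - exact: measurable_int ig.
  (* Only here does the actual recursion meet the error process, which is why the comparison is
     almost sure. *)
  apply: filterS tau_range_ae => w tw _; rewrite lee_fin /g.
  rewrite (_ : _ - _ = (\sum_(0 <= j < M)
      ((sgld_err j w + mu w) ^+ 2 - (mu w ^+ 2 + v))) / M%:R); last first.
    rewrite sumrB sumr_const_nat subn0 -(mulr_natr (mu w ^+ 2 + v)) mulrBl.
    rewrite mulfK ?gt_eqF//.
    by congr (_ / _ - _); apply: eq_bigr => j _; rewrite sgld_theta_err.
  apply: le_trans (sqr_mean_le _ M0) _.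
  rewrite (_ : 3 * _ = (\sum_(0 <= j < M) (3 * ((1 + s^-1) * sgld_err j w ^+ 4 +
     4 * s * mu w ^+ 4 + v ^+ 2))) / M%:R); last first.
    rewrite -mulr_sumr !big_split/= -mulr_sumr !sumr_const_nat subn0.
    rewrite -(mulr_natr (4 * s * mu w ^+ 4)) -(mulr_natr (v ^+ 2)).
    by field; rewrite !gt_eqF.
  rewrite ler_pM2r ?invr_gt0//; apply: ler_sum => j _; exact: sqr_dev_le.
rewrite -[leLHS]fineK; last exact: integrable_fin_num.
rewrite lee_fin -/(Rintegral P setT g) /g RintegralZl// ler_pM2l//.
rewrite RintegralD//; last exact: integrable_EFin_cst.
rewrite RintegralD//; try exact: integrable_EFinZ.
have PT : fine (P setT) = 1 by rewrite probability_setT.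
rewrite Rintegral_cst// [fine _]PT mulr1 !RintegralZl// lerD2r lerD//; last first.
  by rewrite ler_wpM2l ?post_mean_moment4// mulr_ge0// ltW.
rewrite ler_wpM2l//; first by rewrite addr_ge0// invr_ge0 ltW.
rewrite RintegralZr//; last exact: integrable_EFin_sum.
rewrite ler_pM2r ?invr_gt0// Rintegral_sum//.
apply: le_trans (contraction_sum_pow4_le u01 _ (sgld_err_L4 0) sgld_noise_L4
  sgld_noise_moment4 sgld_err_noise0 M) _ => //.
case/andP: u01 => u0 _; rewrite ler_pM2l ?divr_gt0// lerD2r.
apply: le_trans post_mean_moment4; rewrite (eq_Rintegral _ _ (g := fun w => mu w ^+ 4))//.
by move=> w _ /=; ring.
Qed.

End sgld.

(** * Rates *)

Section rates.
Context {R : realType}.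

Lemma natr_powRN_cvg0 (e : R) : 0 < e -> (N%:R : R) `^ (- e) @[N --> \oo] --> 0.
Proof.
move=> e0; apply/cvgrPdist_le => x x0; near=> N.
have N0 : 0 < N%:R :> R by rewrite ltr0n; near: N; exact: nbhs_infty_gt.
rewrite sub0r normrN ger0_norm ?powR_ge0// powRN.
rewrite -[x]invrK lef_pV2 ?posrE ?invr_gt0// ?powR_gt0//.
rewrite -(powR_inv1 (ltW x0)).
have -> : -1 = (- e^-1) * e by rewrite mulNr mulVf// gt_eqF.
rewrite powRrM ge0_ler_powR ?nnegrE ?powR_ge0 ?ltW//.
near: N; exact: nbhs_infty_gtr.
Unshelve. all: end_near. Qed.

(* [q] stands for [N^-eps], [n] for [N], and [u] for [A h]. *)
Lemma error_rate (c q n M u mX mxi : R) : 0 < c -> 0 < q <= 1 -> 1 <= n ->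
  n / (2 * q ^+ 2) <= M -> c * q <= u -> 0 <= mX -> 0 <= mxi ->
  2 / u * (mX + M * (38 / u * (8 * ((q / n * c * n) ^+ 4 * (16 * mX)
     + (q / n) ^+ 2 * mxi)))) / M <=
  (4 * mX / c + 76 * (8 * (16 * (c ^+ 2 * mX))) + 76 * (8 * (mxi / c ^+ 2)) + 1)
  * (q + n^-1).
Proof.
move=> c0 /andP[q0 q1] n1 Mq uq mX0 mxi0.
have n0 : 0 < n by lra.
have cq0 : 0 < c * q by rewrite mulr_gt0.
have u0 : 0 < u by lra.
have M0 : 0 < M by apply: lt_le_trans Mq; rewrite divr_gt0// mulr_gt0// exprn_gt0.
set z := 8 * _.
(* The first term is the initial error averaged over the run, the second the accumulated noise. They
   are bounded separately, from below on [u * M] and on [u]. *)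
have -> : 2 / u * (mX + M * (38 / u * z)) / M =
  2 * mX * (u * M)^-1 + 76 * z * (u ^+ 2)^-1.
  by field; rewrite !gt_eqF.
have cn0 : 0 < c * n / 2 by rewrite divr_gt0 ?mulr_gt0.
have uM : c * n / 2 <= u * M.
  apply: (@le_trans _ _ (c * q * (n / (2 * q ^+ 2)))).
    have -> : c * q * (n / (2 * q ^+ 2)) = c * n / 2 * q^-1 by field; rewrite !gt_eqF.
    by rewrite ler_peMr ?(ltW cn0)// invf_ge1.
  by apply: ler_pM => //; rewrite ltW// divr_gt0// mulr_gt0// exprn_gt0.
have t1 : 2 * mX * (u * M)^-1 <= 4 * mX / c * n^-1.
  have -> : 4 * mX / c * n^-1 = 2 * mX * (c * n / 2)^-1 by field; rewrite !gt_eqF.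
  by rewrite ler_wpM2l ?mulr_ge0// lef_pV2// posrE mulr_gt0.
have z0 : 0 <= z.
  rewrite /z mulr_ge0//; apply: addr_ge0; apply: mulr_ge0 => //.
  - exact: pow4_ge0.
  - exact: mulr_ge0.
  - exact: sqr_ge0.
have t2 : 76 * z * (u ^+ 2)^-1 <=
    76 * (8 * (16 * (c ^+ 2 * mX))) * q ^+ 2 +
    76 * (8 * (mxi / c ^+ 2)) * n^-1 ^+ 2.
  have -> : 76 * (8 * (16 * (c ^+ 2 * mX))) * q ^+ 2 +
      76 * (8 * (mxi / c ^+ 2)) * n^-1 ^+ 2 =
     76 * z * ((c * q) ^+ 2)^-1 by rewrite /z; field; rewrite !gt_eqF.
  apply: ler_wpM2l; first exact: mulr_ge0.
  rewrite lef_pV2 ?posrE ?exprn_gt0//.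
  by rewrite ler_sqr ?nnegrE //; exact: ltW.
have ni0 : 0 < n^-1 by rewrite invr_gt0.
have ni1 : n^-1 <= 1 by rewrite invf_le1.
have q2 : q ^+ 2 <= q by rewrite expr2 ler_piMr// ltW.
have n2 : n^-1 ^+ 2 <= n^-1 by rewrite expr2 ler_piMr// ltW.
have k1 : 0 <= 4 * mX / c by rewrite divr_ge0 ?mulr_ge0// ltW.
have k2 : 0 <= 76 * (8 * (16 * (c ^+ 2 * mX))).
  by do 4 apply: mulr_ge0 => //; exact: sqr_ge0.
have k3 : 0 <= 76 * (8 * (mxi / c ^+ 2)).
  by do 2 apply: mulr_ge0 => //; exact: divr_ge0 (sqr_ge0 _).
move: (4 * mX / c) (76 * (8 * (16 * (c ^+ 2 * mX)))) (76 * (8 * (mxi / c ^+ 2)))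
  k1 k2 k3 t1 t2.
move=> k1 k2 k3 k10 k20 k30 t1 t2.
have := ler_wpM2l k20 q2; have := ler_wpM2l k30 n2.
have := mulr_ge0 k10 (ltW q0); have := mulr_ge0 k20 (ltW ni0).
have := mulr_ge0 k30 (ltW q0); lra.
Qed.

End rates.

(** * The chosen step size, run length and posterior variance in powers of [N] *)

Section sgld_rates.
Context {R : realType} (st sx eps : R).
Hypotheses (st0 : 0 < st) (sx0 : 0 < sx) (eps0 : 0 < eps).
Variable N : nat.
Hypothesis N0 : (0 < N)%N.
Local Notation n := (N%:R : R).
Local Notation q := (n `^ (- eps)).
Local Notation h := (n `^ (-1 - eps)).
Local Notation M := (Num.truncn (n `^ (1 + 2 * eps))).

Let n0 : 0 < n. Proof. by rewrite ltr0n. Qed.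
Let n1 : 1 <= n. Proof. by rewrite ler1n. Qed.
Let q0 : 0 < q. Proof. exact: powR_gt0. Qed.

Lemma sgld_step_sizeE : h = q / n.
Proof.
rewrite powRD; last by rewrite (gt_eqF n0) implybT.
by rewrite powR_inv1 ?ltW// mulrC.
Qed.

Lemma natr_powRN_le1 : q <= 1.
Proof. by rewrite -[leRHS](powRr0 n) ler_powR// oppr_le0 ltW. Qed.

Lemma sgld_steps_gt0 : (0 < M)%N.
Proof.
by rewrite truncn_gt0 -[leLHS](powRr0 n) ler_powR// addr_ge0// mulr_ge0// ltW.
Qed.

(** Truncating a real number that is at least 1 loses at most half of it. *)
Lemma sgld_steps_ge : n / (2 * q ^+ 2) <= M%:R.
Proof.
have -> : n / (2 * q ^+ 2) = n `^ (1 + 2 * eps) / 2.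
  rewrite powRD; last by rewrite (gt_eqF n0) implybT.
  rewrite powRr1 ?ltW// powRN [2 * eps]mulrC powRrM powR_mulrn ?powR_ge0//.
  by field; rewrite gt_eqF// powR_gt0.
have M1 : 1 <= M%:R :> R by rewrite ler1n sgld_steps_gt0.
have : n `^ (1 + 2 * eps) < M%:R + 1 by rewrite natr1 truncnS_gt.
by move: M1; move: (n `^ _) M%:R => x y; lra.
Qed.

Lemma sgld_Ah_ge : (2 * sx ^+ 2)^-1 * q <= sgld_A st sx N * h.
Proof.
rewrite sgld_step_sizeE /sgld_A.
have -> : ((st ^+ 2)^-1 + n / sx ^+ 2) / 2 * (q / n) =
  (2 * sx ^+ 2)^-1 * q + (st ^+ 2)^-1 / 2 * (q / n).
  by field; rewrite !gt_eqF.
rewrite lerDl mulr_ge0 ?divr_ge0 ?invr_ge0 ?sqr_ge0//; exact: ltW.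
Qed.

(** Ensures that the contraction parameter is eventually at most 1. *)
Lemma sgld_Ah_le : sgld_A st sx N * h <= ((st ^+ 2)^-1 + (sx ^+ 2)^-1) * q.
Proof.
rewrite sgld_step_sizeE /sgld_A.
set a := (st ^+ 2)^-1; set b := (sx ^+ 2)^-1.
have a0 : 0 < a by rewrite invr_gt0 exprn_gt0.
have b0 : 0 < b by rewrite invr_gt0 exprn_gt0.
have -> : (a + n / sx ^+ 2) / 2 * (q / n) = (a / n + b) / 2 * q.
  by rewrite /b; field; rewrite !gt_eqF.
rewrite ler_pM2r//; have : a / n <= a by rewrite ler_pdivrMr// ler_peMr// ltW.
lra.
Qed.

Lemma post_var_le : post_var st sx N <= sx ^+ 2 * n^-1.
Proof.
rewrite /post_var -[sx ^+ 2 * _]invf_div.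
have p0 : 0 < n / sx ^+ 2 by rewrite divr_gt0// exprn_gt0.
have a0 : 0 < (st ^+ 2)^-1 by rewrite invr_gt0 exprn_gt0.
rewrite lef_pV2 ?posrE ?addr_gt0// lerDr ltW//.
Qed.

Lemma post_var_ge0 : 0 <= post_var st sx N.
Proof. by rewrite invr_ge0 addr_ge0 ?divr_ge0 ?invr_ge0 ?sqr_ge0. Qed.

End sgld_rates.

(** * Passage to the limit *)

Theorem theorem4 (R : realType) (sigma_theta sigma_x eps : R)
  (d : measure_display) (T : measurableType d) (P : probability T R)
  (X : nat -> nat -> T -> R) (tau : nat -> nat -> T -> nat)
  (xi : nat -> nat -> T -> R) :
  0 < sigma_theta -> 0 < sigma_x -> 0 < eps ->
  (* measurability of all random inputs *)
  (forall N i, measurable_fun setT (X N i)) ->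
  (forall N k, measurable_fun setT (xi N k)) ->
  (forall N k i, measurable (tau N k @^-1` [set i])) ->
  (* data X_1..X_N i.i.d. N(1, sigma_x^2) *)
  (forall N i, (1 <= N)%N -> (1 <= i <= N)%N ->
     forall B, measurable B -> P (X N i @^-1` B) = normal_prob 1 sigma_x B) ->
  (* subsample indices: uniform on {1..N} (random subset of size n = 1) *)
  (forall N k i, (1 <= N)%N -> (1 <= i <= N)%N ->
     P (tau N k @^-1` [set i]) = (N%:R^-1)%:E) ->
  (* Gaussian noise xi_k i.i.d. N(0,1) *)
  (forall N k, (1 <= N)%N ->
     forall B, measurable B -> P (xi N k @^-1` B) = normal_prob 0 1 B) ->
  (* joint mutual independence of data, subsample indices and noise *)
  (forall N, (1 <= N)%N ->
     mutually_independent P (sgld_valid N) (sgld_sigma (X N) (tau N) (xi N))) ->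
  (fun N : nat =>
     let h := (N%:R : R) `^ (-1 - eps) in
     let M := Num.truncn ((N%:R : R) `^ (1 + 2 * eps)) in
     (\int[P]_w
        (((\sum_(0 <= j < M)
             (sgld_theta sigma_theta sigma_x N h (X N) (tau N) (xi N) j w) ^+ 2)
            / M%:R
          - (post_mean sigma_theta sigma_x N (X N) w ^+ 2
             + post_var sigma_theta sigma_x N)) ^+ 2)%:E)%E)
    @ \oo --> (0%:E : \bar R).
Proof.
move=> st0 sx0 eps0 mX mxi mtau lawX lawtau lawxi indep.
pose m4X := \int[normal_prob (1 : R) sigma_x]_x (x ^+ 4).
pose m4xi := \int[normal_prob (0 : R) 1]_x (x ^+ 4).
have m4X0 : 0 <= m4X by apply: Rintegral_ge0 => x _; exact: pow4_ge0.
have m4xi0 : 0 <= m4xi by apply: Rintegral_ge0 => x _; exact: pow4_ge0.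
pose c := (2 * sigma_x ^+ 2)^-1.
have c0 : 0 < c by rewrite invr_gt0 mulr_gt0// exprn_gt0.
(* The constant of [error_rate]; its last summand makes [K], and hence the weight [s N], strictly
   positive. *)
pose K := 4 * m4X / c + 76 * (8 * (16 * (c ^+ 2 * m4X))) + 76 * (8 * (m4xi / c ^+ 2)) + 1.
have K0 : 0 < K.
  have c20 : 0 <= c ^+ 2 by exact: sqr_ge0.
  have c0' := ltW c0.
  by rewrite ltr_wpDl// !addr_ge0//; repeat (apply: mulr_ge0 => //); rewrite invr_ge0.
(* The weight is the square root of the bound on the averaged fourth moment. Then [1 + (s N)^-1]
   times that bound is [s N ^+ 2 + s N], which vanishes together with [4 * s N * m4X]. *)
pose s (N : nat) : R := Num.sqrt (K * ((N%:R : R) `^ (- eps) + (N%:R : R) `^ (-1))).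
pose B (N : nat) : R := 3 * (s N ^+ 2 + s N + 4 * s N * m4X +
  (sigma_x ^+ 2 * (N%:R : R) `^ (-1)) ^+ 2).
have qcvg := natr_powRN_cvg0 eps0.
have ncvg := natr_powRN_cvg0 (@ltr01 R).
have scvg : s N @[N --> \oo] --> 0.
  rewrite -[X in _ --> X](_ : Num.sqrt (K * (0 + 0)) = 0); last first.
    by rewrite addr0 mulr0 sqrtr0.
  apply: continuous_cvg; first exact: sqrt_continuous.
  by apply: cvgM; [exact: cvg_cst|exact: cvgD].
have Bcvg : B N @[N --> \oo] --> 0.
  rewrite -[X in _ --> X](_ : 3 * (0 * 0 + 0 + 4 * 0 * m4X +
      (sigma_x ^+ 2 * 0) * (sigma_x ^+ 2 * 0)) = 0); last by ring.
  apply: cvgM; first exact: cvg_cst.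
  apply: cvgD; last by apply: cvgM; apply: cvgM => //; exact: cvg_cst.
  apply: cvgD; last by apply: cvgM; [apply: cvgM => //|]; exact: cvg_cst.
  by apply: cvgD => //; exact: cvgM.
apply: (@squeeze_cvge _ _ _ _ (fun=> 0%E) _ (fun N => (B N)%:E)); last 2 first.
- exact: cvg_cst.
- by apply: cvg_EFin; [exact: nearW|exact: Bcvg].
pose C := (sigma_theta ^+ 2)^-1 + (sigma_x ^+ 2)^-1.
have C0 : 0 < C by rewrite addr_gt0// invr_gt0 exprn_gt0.
near=> N.
have N0 : (0 < N)%N by near: N; exact: nbhs_infty_gt.
(* From this rank on, [sgld_Ah_le] gives the upper half of [u01]. *)
have qC : (N%:R : R) `^ (- eps) <= C^-1.
  near: N; apply: (cvgr_le _ qcvg); by rewrite invr_gt0.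
apply/andP; split; first by apply: integral_ge0 => w _; rewrite lee_fin sqr_ge0.
have q0 : 0 < (N%:R : R) `^ (- eps) by rewrite powR_gt0// ltr0n.
have ni0 : 0 < (N%:R : R) `^ (-1) by rewrite powR_gt0// ltr0n.
have h0 : 0 < (N%:R : R) `^ (-1 - eps) by rewrite powR_gt0// ltr0n.
have s0 : 0 < s N by rewrite sqrtr_gt0 mulr_gt0// addr_gt0.
have Ah_ge := sgld_Ah_ge eps st0 sx0 N0.
have Ah_le := sgld_Ah_le eps st0 sx0 N0.
have u01 : 0 < sgld_A sigma_theta sigma_x N * (N%:R : R) `^ (-1 - eps) <= 1.
  rewrite (lt_le_trans _ Ah_ge) ?mulr_gt0//= (le_trans Ah_le)//.
  by rewrite -/C mulrC -ler_pdivlMr// div1r.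
have M0 := sgld_steps_gt0 eps0 N0.
apply: le_trans (sgld_mean_square_error_le st0 sx0 h0 N0 (mX N) (mxi N) (mtau N)
  (fun i => lawX N i N0) (fun k i => lawtau N k i N0) (fun k => lawxi N k N0)
  (indep N N0) u01 M0 s0) _.
rewrite lee_fin /B ler_pM2l// -/m4X lerD//; last first.
  rewrite ler_sqr ?nnegrE ?post_var_ge0//; last by rewrite mulr_ge0 ?sqr_ge0 ?ltW.
  by rewrite powR_inv1//; exact: post_var_le.
rewrite lerD2r.
set b := _ / _ * _ / _.
have bs : b <= s N ^+ 2.
  rewrite sqr_sqrtr; last by apply: mulr_ge0; [exact: ltW|apply: addr_ge0; exact: ltW].
  rewrite powR_inv1// /b /noise_bound -/m4X -/m4xi -/c.
  rewrite [in X in X * c * N%:R]sgld_step_sizeE//.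
  rewrite [in X in X ^+ 2 * m4xi]sgld_step_sizeE//.
  have q01 : 0 < (N%:R : R) `^ (- eps) <= 1 by rewrite q0 natr_powRN_le1.
  have n1 : 1 <= N%:R :> R by rewrite ler1n.
  exact: (error_rate c0 q01 n1 (sgld_steps_ge eps0 N0) Ah_ge m4X0 m4xi0).
have -> : s N ^+ 2 + s N = (1 + (s N)^-1) * s N ^+ 2 by field; rewrite gt_eqF.
by rewrite ler_pM2l// addr_gt0// invr_gt0.
Unshelve. all: end_near. Qed.
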